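(* Let $(G,\alpha)$ be an involutive finite Hom-group, and let $p$ be a prime divisor of the order $|G|$ of $G$. Then $G$ has a $p$-Sylow Hom-subgroup.
   Context: A Hom-group $(G,\alpha)$ is a set $G$ together with a distinguished element $1\in G$ (the unit), a bijective map $\alpha:G\to G$ and a binary operation $G\times G\to G$, $(g,h)\mapsto gh$, such that for all $g,h,k\in G$: (1) $\alpha(g)(hk)=(gh)\alpha(k)$; (2) $\alpha(gh)=\alpha(g)\alpha(h)$; (3) $g1=1g=\alpha(g)$; (4) there exists $g^{-1}\in G$ with $gg^{-1}=g^{-1}g=1$. A Hom-group $(G,\alpha)$ is called involutive if $\alpha^2=\alpha$. A Hom-subgroup of a Hom-group $(G,\alpha)$ is a nonempty subset $H\subseteq G$ closed under the product such that $(H,\alpha)$ (with $\alpha$ restricted to a bijection $H\to H$) is itself a Hom-group under the product of $G$. If $|G|=p^km$ with $p$ prime and $p\nmid m$, a $p$-Sylow Hom-subgroup of $G$ is a Hom-subgroup of $G$ with exactly $p^k$ elements. *)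

(* Defs.v *)
From mathcomp Require Import all_boot.

Set Implicit Arguments.
Unset Strict Implicit.
Unset Printing Implicit Defensive.

Record hom_group (T : Type) := HomGroup {
  hg_one : T;
  hg_alpha : T -> T;
  hg_mul : T -> T -> T;
  hg_alpha_bij : bijective hg_alpha;
  hg_assoc : forall g h k,
    hg_mul (hg_alpha g) (hg_mul h k) = hg_mul (hg_mul g h) (hg_alpha k);
  hg_alphaM : forall g h,
    hg_alpha (hg_mul g h) = hg_mul (hg_alpha g) (hg_alpha h);
  hg_mulg1 : forall g, hg_mul g hg_one = hg_alpha g;
  hg_mul1g : forall g, hg_mul hg_one g = hg_alpha g;
  hg_inv : forall g, exists g', hg_mul g g' = hg_one /\ hg_mul g' g = hg_one
}.

(* In this theory "involutive" means that alpha squared is alpha itself,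
   not the identity. *)
Definition hom_involutive (T : Type) (G : hom_group T) : Prop :=
  forall g, hg_alpha G (hg_alpha G g) = hg_alpha G g.

(* The Hom-group K on the subtype of H carries the product and the twisting map
   of G; its unit is not assumed to be that of G. *)
Definition hom_subgroup (T : Type) (G : hom_group T) (H : {pred T}) : Prop :=
  [/\ exists x, x \in H,
      {in H &, forall x y, hg_mul G x y \in H}
    & exists K : hom_group {x | x \in H},
        (forall x, val (hg_alpha K x) = hg_alpha G (val x)) /\
        (forall x y, val (hg_mul K x y) = hg_mul G (val x) (val y))].

Definition sylow_hom_subgroup (p : nat) (T : finType) (G : hom_group T)
    (H : {set T}) : Prop :=
  hom_subgroup G H /\
  exists k m, [/\ #|T| = p ^ k * m, ~~ (p %| m) & #|H| = p ^ k].

(* Main.v *)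
From HB Require Import structures.
Require Import Defs.
From mathcomp Require Import all_boot all_fingroup all_solvable.

(** A twisting map is bijective, hence injective, so [alpha (alpha g) = alpha g]
    forces [alpha g = g]: the twist of an involutive Hom-group is the identity
    ([hom_involutive_id]).  The Hom-associativity and unit laws then read as
    the ordinary ones, and an involutive finite Hom-group is nothing but a
    finite group ([untwisted]).  The classical theorem of Sylow gives a
    subgroup [P] of order the [p]-part of the order of the group, and every
    subgroup, with the identity as twist, is a Hom-subgroup
    ([group_hom_subgroup]). *)

Set Implicit Arguments.
Unset Strict Implicit.
Unset Printing Implicit Defensive.

Lemma hom_involutive_id (T : Type) (G : hom_group T) :
  hom_involutive G -> hg_alpha G =1 id.
Proof. by move=> hG g; apply: (bij_inj (hg_alpha_bij G)); apply: hG. Qed.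

(** A copy of [T] that remembers [G] and [hG], so that the group structure they
    determine can be inferred from the type. *)
Definition untwisted (T : finType) (G : hom_group T) (hG : hom_involutive G) :
  Type := T.

HB.instance Definition _ (T : finType) (G : hom_group T)
  (hG : hom_involutive G) := Finite.copy (untwisted hG) T.

(** Inverses exist by hypothesis, so the default [g] is never reached; choosing
    a left inverse is all that the group axioms below ask for. *)
Definition hom_inverse (T : finType) (G : hom_group T) (g : T) : T :=
  odflt g [pick g' | hg_mul G g' g == hg_one G].

Lemma hom_mulA (T : finType) (G : hom_group T) :
  hom_involutive G -> associative (hg_mul G).
Proof.
by move=> hG x y z; have:= hg_assoc G x y z; rewrite !(hom_involutive_id hG).
Qed.

Lemma hom_mul1 (T : finType) (G : hom_group T) :
  hom_involutive G -> left_id (hg_one G) (hg_mul G).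
Proof. by move=> hG x; rewrite hg_mul1g (hom_involutive_id hG). Qed.

Lemma hom_mulV (T : finType) (G : hom_group T) :
  left_inverse (hg_one G) (@hom_inverse T G) (hg_mul G).
Proof.
move=> x; rewrite /hom_inverse; case: pickP => [y /eqP //|no_inv].
by have [y [_ yx]] := hg_inv G x; have:= no_inv y; rewrite yx eqxx.
Qed.

HB.instance Definition _ (T : finType) (G : hom_group T)
    (hG : hom_involutive G) :=
  Finite_isGroup.Build (untwisted hG)
    (hom_mulA hG) (hom_mul1 hG) (@hom_mulV T G).

(** A set over the copy is not literally a set over [T]: the two finite-type
    structures are distinct terms, so subsets are transported elementwise. *)
Definition retwist (T : finType) (G : hom_group T) (hG : hom_involutive G)
  (A : {set untwisted hG}) : {set T} := [set x : T | (x : untwisted hG) \in A].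

Lemma card_retwist (T : finType) (G : hom_group T) (hG : hom_involutive G)
  (A : {set untwisted hG}) : #|retwist A| = #|A|.
Proof.
have inj_id : injective (id : untwisted hG -> T) by [].
rewrite -(card_imset _ inj_id); apply: eq_card => x; rewrite inE.
by apply/idP/imsetP => [Ax | [y Ay ->]] //; exists x.
Qed.

(** The twist of the Hom-group on [P] has to be the restriction of that of [G],
    which is the identity; with the identity as twist, the Hom-group axioms on
    [P] are its group axioms, and they restrict from the ambient group. *)
Lemma group_hom_subgroup (T : finType) (G : hom_group T)
    (hG : hom_involutive G) (P : {group untwisted hG}) :
  hom_subgroup G (retwist P).
Proof.
have PM (x y : T) : x \in retwist P -> y \in retwist P ->
    hg_mul G x y \in retwist P.
  by rewrite !inE; apply: groupM.
pose S := {x : T | x \in retwist P}.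
pose elt (x : T) (Px : x \in retwist P) : S := exist _ x Px.
pose mulS (x y : S) : S := elt _ (PM _ _ (valP x) (valP y)).
have P1 : hg_one G \in retwist P by rewrite inE; apply: (group1 P).
pose oneS : S := elt _ P1.
split=> //; first by exists (hg_one G).
have bijS : bijective (@id S) by exists id.
have mulSA (x y z : S) : mulS x (mulS y z) = mulS (mulS x y) z.
  by apply: val_inj; apply: (hom_mulA hG).
have mulS1 (x : S) : mulS x oneS = x.
  by apply: val_inj; apply: (@mulg1 (untwisted hG)).
have mul1S (x : S) : mulS oneS x = x.
  by apply: val_inj; apply: (@mul1g (untwisted hG)).
have invS (x : S) : exists x', mulS x x' = oneS /\ mulS x' x = oneS.
  have Vx : hom_inverse G (val x) \in retwist P.
    by have:= valP x; rewrite !inE => Px; apply: groupVr.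
  exists (elt _ Vx); split; apply: val_inj.
    exact: (@mulgV (untwisted hG)).
  exact: (@mulVg (untwisted hG)).
exists (HomGroup bijS mulSA (fun _ _ => erefl) mulS1 mul1S invS).
by split=> // x; rewrite (hom_involutive_id hG).
Qed.

Theorem theorem7p2 (T : finType) (G : hom_group T) (p : nat)
    (hG : hom_involutive G) (hp : prime p) (hpG : p %| #|T|) :
  exists H : {set T}, sylow_hom_subgroup p G H.
Proof.
have [P sylP] := Sylow_exists p [set: untwisted hG].
exists (retwist P); split; first exact: group_hom_subgroup.
have T_gt0 : 0 < #|T| by apply/card_gt0P; exists (hg_one G).
have [m co_p_m oT] := pfactor_coprime hp T_gt0.
exists (logn p #|T|), m; split; first by rewrite mulnC.
  by rewrite -prime_coprime.
have oG : #|[set: untwisted hG]| = #|T|.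
  by rewrite -card_retwist -cardsT; apply: eq_card => x; rewrite !inE.
by rewrite card_retwist (card_Hall sylP) p_part oG.
Qed.
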